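(* Let $A\in\mathbb{R}^{n\times n}$ be an M-matrix that has a triplet representation. Then the principal square root $A^{1/2}$ of $A$ exists, and it is an M-matrix that has a triplet representation.
   Context: Inequalities between real matrices or vectors are entrywise: $B\ge 0$ means all entries are $\ge 0$, and $\boldsymbol{u}>0$ means all entries are $>0$. A real square matrix $A$ is an M-matrix if $A=\alpha I-B$ with $B\ge 0$ and $\alpha\ge\rho(B)$, where $\rho(B)$ is the spectral radius of $B$ (so an M-matrix may be singular). A triplet representation of an M-matrix $A=(a_{ij})\in\mathbb{R}^{n\times n}$ is a triple $(P,\boldsymbol{u},\boldsymbol{v})$ where $P=(p_{ij})$ is the nonnegative matrix with $p_{ij}=-a_{ij}$ for $i\ne j$ and $p_{ii}=0$, and $\boldsymbol{u},\boldsymbol{v}\in\mathbb{R}^n$ are vectors with $\boldsymbol{u}>0$, $\boldsymbol{v}\ge 0$ and $A\boldsymbol{u}=\boldsymbol{v}$. The principal square root $A^{1/2}$ of $A$ is the unique (when it exists) matrix $X$ such that $X^2=A$, $X$ is a polynomial in $A$, and all nonzero eigenvalues of $X$ have positive real part. *)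

(* Defs.v *)
From HB Require Import structures.
From mathcomp Require Import all_boot all_order all_algebra.
From mathcomp Require Import classical_sets reals complex.

Set Implicit Arguments.
Unset Strict Implicit.
Unset Printing Implicit Defensive.

Import Order.TTheory GRing.Theory Num.Theory.
Local Open Scope classical_set_scope.
Local Open Scope ring_scope.

(* Square matrices are taken in 'M_n.+1, i.e. of order at least 1, so that
   they form a nontrivial ring and horner_mx is available. *)

Definition complex_mx (R : realType) (m n : nat) (A : 'M[R]_(m, n)) :
    'M[R[i]]_(m, n) :=
  map_mx (real_complex R) A.

(* The eigenvalues are the complex ones.  Their set is finite and nonempty, so
   this supremum is a maximum. *)
Definition spectral_radius (R : realType) (n : nat) (B : 'M[R]_n.+1) : R :=
  sup [set Normc.normc z | z in [set z | eigenvalue (complex_mx B) z]].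

Definition mx_nonneg (R : realType) (m n : nat) (B : 'M[R]_(m, n)) : Prop :=
  forall i j, 0 <= B i j.

Definition mx_pos (R : realType) (m n : nat) (B : 'M[R]_(m, n)) : Prop :=
  forall i j, 0 < B i j.

Definition is_Mmatrix (R : realType) (n : nat) (A : 'M[R]_n.+1) : Prop :=
  exists (alpha : R) (B : 'M[R]_n.+1),
    [/\ A = alpha%:M - B, mx_nonneg B & spectral_radius B <= alpha].

Definition triplet_representation (R : realType) (n : nat) (A : 'M[R]_n.+1)
    (P : 'M[R]_n.+1) (u v : 'cV[R]_n.+1) : Prop :=
  [/\ P = \matrix_(i, j) (if i == j then 0 else - A i j),
      mx_nonneg P, mx_pos u, mx_nonneg v & A *m u = v].

Definition has_triplet_representation (R : realType) (n : nat)
    (A : 'M[R]_n.+1) : Prop :=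
  exists (P : 'M[R]_n.+1) (u v : 'cV[R]_n.+1), triplet_representation A P u v.

Definition principal_sqrt_spec (R : realType) (n : nat)
    (A X : 'M[R[i]]_n.+1) : Prop :=
  [/\ X ^+ 2 = A,
      exists p : {poly R[i]}, X = horner_mx A p &
      forall z : R[i], eigenvalue X z -> z != 0 -> 0 < complex.Re z].

(* X is the only matrix, among all complex ones, meeting the specification. *)
Definition is_principal_sqrt (R : realType) (n : nat)
    (A X : 'M[R[i]]_n.+1) : Prop :=
  unique (principal_sqrt_spec A) X.

(* Main.v *)
(* Write A = s (1 - Q) with s > 0 large; then Q >= 0 and Q u <= u.  The iteration
   Y := (Q + Y^2) / 2 started at 0 is entrywise increasing and keeps Y u <= u, so
   it converges to some Y >= 0 with (1 - Y)^2 = 1 - Q and Y u <= u; the candidate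
   is X = sqrt s (1 - Y).  It is a limit of polynomials in A, hence a polynomial
   in A, as these form a finite-dimensional space.  The eigenvalues of Y lie in
   the closed unit disc, so those of X are 0 or in the open right half-plane.
   For uniqueness let Z = X1 - X2 and W = X1 + X2, so that Z W = 0.  If Z A <> 0,
   some nonzero multiple K of Z A satisfies K X1 = l K, so K X2 = - l K; both
   l and - l being admissible, l = 0, and K A = K X1^2 = 0, which contradicts the
   semisimplicity of the eigenvalue 0 of A (the powers of Q are bounded).  So
   Z A = 0; if A is singular, Z is itself a polynomial multiple of A, and
   semisimplicity gives Z = 0. *)
Require Import Defs.
From HB Require Import structures.
From mathcomp Require Import all_boot all_order all_algebra.
From mathcomp Require Import classical_sets reals complex.
From mathcomp Require Import boolp functions topology normedtype sequences.
From mathcomp Require Import ring lra.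

Set Implicit Arguments.
Unset Strict Implicit.
Unset Printing Implicit Defensive.

Import Order.TTheory GRing.Theory Num.Theory.
Import numFieldNormedType.Exports.
Local Open Scope ring_scope.

(** * Nonnegative matrices with a positive supersolution [u] *)

Section NonnegMx.
Variable R : realType.

Lemma mx_nonnegD m n (B C : 'M[R]_(m, n)) :
  mx_nonneg B -> mx_nonneg C -> mx_nonneg (B + C).
Proof. by move=> B0 C0 i j; rewrite mxE addr_ge0. Qed.

Lemma mx_nonnegZ m n a (B : 'M[R]_(m, n)) :
  0 <= a -> mx_nonneg B -> mx_nonneg (a *: B).
Proof. by move=> a0 B0 i j; rewrite mxE mulr_ge0. Qed.

Lemma mx_nonnegM m n p (B : 'M[R]_(m, n)) (C : 'M[R]_(n, p)) :
  mx_nonneg B -> mx_nonneg C -> mx_nonneg (B *m C).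
Proof.
by move=> B0 C0 i j; rewrite mxE; apply: sumr_ge0 => k _; rewrite mulr_ge0.
Qed.

(** Keep a single term of the nonnegative sum (Y u)_i <= u_i. The bound does not depend on [Y], so
    it applies to all iterates at once. *)
Lemma supersolution_entry_le n (Y : 'M[R]_n.+1) (u : 'cV[R]_n.+1) :
  mx_nonneg Y -> mx_pos u -> mx_nonneg (u - Y *m u) ->
  forall i j, Y i j <= u i 0 / u j 0.
Proof.
move=> Y0 u0 Yu i j; rewrite ler_pdivlMr //.
have := Yu i 0; rewrite !mxE subr_ge0; apply: le_trans.
rewrite (bigD1 j) //= lerDl sumr_ge0 // => k _.
by rewrite mulr_ge0 // ltW.
Qed.

(** A left eigenvector v satisfies |z| |v_j| <= sum_i |v_i| Y_ij. Pairing with [u] gives |z| S <= c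
    S, where S = sum_j |v_j| u_j is positive. *)
Lemma supersolution_eigenvalue_le n (Y : 'M[R]_n.+1) (u : 'cV[R]_n.+1) c z :
  mx_nonneg Y -> mx_pos u -> mx_nonneg (c *: u - Y *m u) ->
  eigenvalue (complex_mx Y) z -> Normc.normc z <= c.
Proof.
move=> Y0 u0 Yu /eigenvalueP [v vY vn0].
have normE (x : R[i]) : (Normc.normc x)%:C%C = `|x| by [].
have wge j : 0 <= Normc.normc (v 0 j) by case: (v 0 j) => a b; exact: sqrtr_ge0.
have key j : Normc.normc z * Normc.normc (v 0 j) <=
    \sum_i Normc.normc (v 0 i) * Y i j.
  rewrite -Normc.normcM -lecR rmorph_sum normE.
  have -> : z * v 0 j = \sum_i v 0 i * (Y i j)%:C%C.
    have := congr1 (fun M : 'M_(_, _) => M 0 j) vY; rewrite !mxE => <-.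
    by apply: eq_bigr => i _; rewrite mxE.
  apply: le_trans (ler_norm_sum _ _ _) _; apply: ler_sum => i _.
  rewrite normrM rmorphM /= normE ler_wpM2l ?normr_ge0 //.
  by rewrite ger0_norm // ler0c.
set S := \sum_j Normc.normc (v 0 j) * u j 0.
have S_gt0 : 0 < S.
  have /existsP [j vj0] : [exists j, v 0 j != 0].
    rewrite -negb_forall; apply: contra vn0 => /forallP v0.
    by apply/eqP/rowP => j; rewrite mxE; apply/eqP.
  rewrite /S (bigD1 j) //=; apply: ltr_pwDl.
    rewrite mulr_gt0 // lt_def wge andbT.
    by apply: contra vj0 => /eqP /Normc.eq0_normc ->.
  by apply: sumr_ge0 => i _; rewrite mulr_ge0 // ltW.
rewrite -(ler_pM2r S_gt0) {1}/S mulr_sumr.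
apply: (@le_trans _ _ (\sum_j (\sum_i Normc.normc (v 0 i) * Y i j) * u j 0)).
  by apply: ler_sum => j _; rewrite mulrA ler_wpM2r // ltW.
under eq_bigr => j _ do rewrite mulr_suml.
rewrite exchange_big /S mulr_sumr /=; apply: ler_sum => i _.
under eq_bigr => j _ do rewrite -mulrA.
rewrite -mulr_sumr mulrCA ler_wpM2l //.
by have := Yu i 0; rewrite !mxE subr_ge0.
Qed.

Lemma supersolution_spectral_radius_le n (Y : 'M[R]_n.+1) (u : 'cV[R]_n.+1) c :
  mx_nonneg Y -> mx_pos u -> 0 <= c -> mx_nonneg (c *: u - Y *m u) ->
  spectral_radius Y <= c.
Proof.
move=> Y0 u0 c0 Yu; rewrite /spectral_radius.
set E := (X in sup X).
(* The supremum of the empty set is 0, so [0 <= c] covers this case without proving that an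
   eigenvalue exists. *)
have [->|E0] := eqVneq E set0; first by rewrite sup0.
apply: ge_sup; first exact/set0P.
by move=> _ [z /= ez <-]; apply: supersolution_eigenvalue_le ez.
Qed.

(** [Q] does not expand the sup norm weighted by [u]; iterating this bounds all powers of [Q]. *)
Lemma mulmx_bound n (Q : 'M[R]_n.+1) (u : 'cV[R]_n.+1) m
    (M : 'M[R]_(n.+1, m)) c :
  mx_nonneg Q -> mx_nonneg (u - Q *m u) -> 0 <= c ->
  (forall i j, `|M i j| <= c * u i 0) ->
  forall i j, `|(Q *m M) i j| <= c * u i 0.
Proof.
move=> Q0 Qu c0 Mc i j; rewrite mxE.
apply: le_trans (ler_norm_sum _ _ _) _.
apply: (@le_trans _ _ (\sum_k Q i k * (c * u k 0))).
  by apply: ler_sum => k _; rewrite normrM (ger0_norm (Q0 _ _)) ler_wpM2l.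
under eq_bigr => k _ do rewrite mulrCA.
rewrite -mulr_sumr ler_wpM2l //.
by have := Qu i 0; rewrite !mxE subr_ge0.
Qed.

(* If D = (1 - Q) M is fixed by Q then Q^k M = M - k D; since the powers of Q
   are bounded, D vanishes. *)
Lemma supersolution_index1 n (Q : 'M[R]_n.+1) (u : 'cV[R]_n.+1) m
    (M : 'M[R]_(n.+1, m)) :
  mx_nonneg Q -> mx_pos u -> mx_nonneg (u - Q *m u) ->
  (1%:M - Q) *m ((1%:M - Q) *m M) = 0 -> (1%:M - Q) *m M = 0.
Proof.
move=> Q0 u0 Qu; set D := (1%:M - Q) *m M => QD.
have {}QD : Q *m D = D.
  by apply/esym/eqP; rewrite -subr_eq0 -{1}[D]mul1mx -mulmxBl QD.
have QM : Q *m M = M - D by rewrite /D mulmxBl mul1mx subKr.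
clearbody D.
pose c := \sum_i \sum_j `|M i j| / u i 0.
have c0 : 0 <= c.
  by apply: sumr_ge0 => i _; apply: sumr_ge0 => j _; rewrite divr_ge0 // ltW.
have Mc i j : `|M i j| <= c * u i 0.
  rewrite -ler_pdivrMr // /c (bigD1 i) //= (bigD1 j) //= -addrA lerDl.
  by apply: addr_ge0; apply: sumr_ge0 => k _ //;
    [|apply: sumr_ge0 => l _]; rewrite divr_ge0 // ltW.
have bound k : forall i j, `|(M - D *+ k) i j| <= c * u i 0.
  elim: k => [|k IHk]; first by rewrite mulr0n subr0.
  have -> : M - D *+ k.+1 = Q *m (M - D *+ k).
    rewrite mulmxBr -[D *+ k]scaler_nat -scalemxAr QD scaler_nat QM.
    by rewrite mulrS opprD addrA.
  exact: mulmx_bound.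
apply/matrixP => i j; rewrite [RHS]mxE; apply/eqP; rewrite -normr_le0 leNgt.
apply/negP => Dij.
(* Both M and M - k D are bounded by c u_i, so k |D_ij| <= 2 c u_i for every k; a natural number
   above [b] violates this. *)
pose b := 2 * (c * u i 0) / `|D i j|.
have b0 : 0 <= b by rewrite divr_ge0 ?mulr_ge0 // ltW.
have := archi_boundP b0; set k := Num.Def.archi_bound b.
apply/negP; rewrite -leNgt /b ler_pdivlMr //.
have -> : k%:R * `|D i j| = `|M i j - (M - D *+ k) i j|.
  rewrite mxE [(- (D *+ k)) i j]mxE subKr.
  by rewrite mulmxnE normrMn mulr_natl.
by apply: le_trans (ler_normB _ _) _; rewrite mulr_natl mulr2n lerD.
Qed.

End NonnegMx.

(** * The monotone iteration and its limit *)

Section SqrtIteration.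
Local Open Scope classical_set_scope.
Variables (R : realType) (n : nat).
Implicit Types (A Q Y : 'M[R]_n.+1) (u : 'cV[R]_n.+1).

Definition mx_cvg m p (F : nat -> 'M[R]_(m, p)) (L : 'M[R]_(m, p)) :=
  forall i j, F k i j @[k --> \oo] --> L i j.

Lemma mx_cvg_mulmx m p q (F : nat -> 'M[R]_(m, p)) (G : nat -> 'M[R]_(p, q))
    L K :
  mx_cvg F L -> mx_cvg G K -> mx_cvg (fun k => F k *m G k) (L *m K).
Proof.
move=> FL GK i j; rewrite mxE.
under eq_fun do rewrite mxE.
apply: cvg_big => [|l _]; last exact: cvgM (FL i l) (GK l j).
exact: add_continuous.
Qed.

Lemma mx_cvg_unique m p (F : nat -> 'M[R]_(m, p)) L K :
  mx_cvg F L -> mx_cvg F K -> L = K.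
Proof.
move=> FL FK; apply/matrixP => i j.
exact: (cvg_unique (@Rhausdorff R) (FL i j) (FK i j)).
Qed.

Lemma mx_cvg_cst m p (L : 'M[R]_(m, p)) : mx_cvg (fun=> L) L.
Proof. by move=> i j; exact: cvg_cst. Qed.

Lemma mx_cvg_nonneg m p (F : nat -> 'M[R]_(m, p)) L :
  mx_cvg F L -> (forall k, mx_nonneg (F k)) -> mx_nonneg L.
Proof.
move=> FL F0 i j; apply: cvgr_to_ge (FL i j) _.
by apply: nearW => k; exact: F0.
Qed.

(** The polynomials in [A] form the row space of its vectorised powers. Membership means being
    killed by a cokernel matrix, a linear condition that passes to the limit. *)
Lemma mx_cvg_poly A (F : nat -> 'M[R]_n.+1) L :
  mx_cvg F L -> (forall k, exists p, F k = horner_mx A p) ->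
  exists p, L = horner_mx A p.
Proof.
move=> FL Fp; exists (mx_inv_horner A L).
rewrite mx_inv_hornerK // submxE; apply/eqP.
set C := cokermx _.
have cvgF : mx_cvg (fun k => mxvec (F k) *m C) (mxvec L *m C).
  apply: (mx_cvg_mulmx (F := fun k => mxvec (F k)) _ (@mx_cvg_cst _ _ C)) => i j.
  case/mxvec_indexP: j => a b; rewrite (ord1 i) mxvecE.
  by under eq_fun do rewrite mxvecE; exact: FL.
have cvg0 : mx_cvg (fun k => mxvec (F k) *m C) 0.
  have -> : (fun k => mxvec (F k) *m C) = fun=> 0.
    apply/funext => k; have [p ->] := Fp k.
    by apply/eqP; rewrite -submxE horner_mx_mem.
  exact: mx_cvg_cst.
exact: mx_cvg_unique cvgF cvg0.
Qed.

Definition sqrt_iter Q k := iter k (fun Y => 2^-1 *: (Q + Y *m Y)) 0.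

Lemma sqrt_iter_nonneg Q k : mx_nonneg Q -> mx_nonneg (sqrt_iter Q k).
Proof.
move=> Q0; elim: k => [|k IHk] /=; first by move=> i j; rewrite mxE.
by apply/mx_nonnegZ/mx_nonnegD/mx_nonnegM => //; rewrite invr_ge0.
Qed.

(** For consecutive iterates Y and Z, the next increment is half of Z^2 - Y^2 = Z (Z - Y) + (Z - Y)
    Y, a sum of products of nonnegative matrices. *)
Lemma sqrt_iterS_nonneg Q k :
  mx_nonneg Q -> mx_nonneg (sqrt_iter Q k.+1 - sqrt_iter Q k).
Proof.
move=> Q0; elim: k => [|k IHk].
  by rewrite subr0; exact: sqrt_iter_nonneg.
rewrite {1}/sqrt_iter iterS -/(sqrt_iter Q k.+1).
set Z := sqrt_iter Q k.+1 in IHk *.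
have -> : Z = 2^-1 *: (Q + sqrt_iter Q k *m sqrt_iter Q k) by [].
set Y := sqrt_iter Q k in IHk *.
rewrite -/(sqrt_iter Q k.+1) -/Z -scalerBr opprD addrACA subrr add0r.
have -> : Z *m Z - Y *m Y = Z *m (Z - Y) + (Z - Y) *m Y.
  by rewrite mulmxBr mulmxBl addrA subrK.
apply: mx_nonnegZ; first by rewrite invr_ge0.
by apply: mx_nonnegD; apply: mx_nonnegM => //; exact: sqrt_iter_nonneg.
Qed.

Lemma sqrt_iter_supersolution Q u k :
  mx_nonneg Q -> mx_pos u -> mx_nonneg (u - Q *m u) ->
  mx_nonneg (u - sqrt_iter Q k *m u).
Proof.
move=> Q0 u0 Qu; elim: k => [|k IHk].
  by rewrite mul0mx subr0 => i j; rewrite ltW.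
have -> : u - sqrt_iter Q k.+1 *m u =
    2^-1 *: ((u - Q *m u) + (u - sqrt_iter Q k *m u)
             + sqrt_iter Q k *m (u - sqrt_iter Q k *m u)).
  rewrite /sqrt_iter iterS -/(sqrt_iter Q k); set Y := sqrt_iter Q k.
  rewrite -scalemxAl mulmxDl mulmxBr -mulmxA.
  move: (Y *m (Y *m u)) (Y *m u) (Q *m u) => a b c.
  by apply/matrixP => i j; rewrite !mxE; field.
apply: mx_nonnegZ; first by rewrite invr_ge0.
by do !apply: mx_nonnegD => //; apply: mx_nonnegM => //; exact: sqrt_iter_nonneg.
Qed.

Lemma sqrt_iter_poly A Q k :
  (exists q, Q = horner_mx A q) -> exists p, sqrt_iter Q k = horner_mx A p.
Proof.
move=> [q ->]; elim: k => [|k [p IHk]]; first by exists 0; rewrite rmorph0.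
exists (2^-1 *: (q + p * p)); rewrite linearZ rmorphD rmorphM /=.
by rewrite -IHk.
Qed.

Lemma sqrt_iter_cvg Q u :
  mx_nonneg Q -> mx_pos u -> mx_nonneg (u - Q *m u) ->
  exists Y, mx_cvg (sqrt_iter Q) Y.
Proof.
move=> Q0 u0 Qu.
exists (\matrix_(i, j) lim (sqrt_iter Q k i j @[k --> \oo])) => i j.
rewrite mxE; apply: nondecreasing_is_cvgn.
  apply/nondecreasing_seqP => k.
  by have := sqrt_iterS_nonneg k Q0 i j; rewrite !mxE subr_ge0.
exists (u i 0 / u j 0) => _ [k _ <-].
apply: supersolution_entry_le => //; first exact: sqrt_iter_nonneg.
exact: sqrt_iter_supersolution.
Qed.

Lemma nonneg_sqrt_fixpoint A Q u :
  mx_nonneg Q -> mx_pos u -> mx_nonneg (u - Q *m u) ->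
  (exists q, Q = horner_mx A q) ->
  exists Y, [/\ mx_nonneg Y, mx_nonneg (u - Y *m u),
    (1 - Y) ^+ 2 = 1 - Q & exists p, Y = horner_mx A p].
Proof.
move=> Q0 u0 Qu QA; have [Y cY] := sqrt_iter_cvg Q0 u0 Qu.
exists Y; split.
- by apply: mx_cvg_nonneg cY _ => k; exact: sqrt_iter_nonneg.
- apply: (mx_cvg_nonneg (F := fun k => u - sqrt_iter Q k *m u)).
    have cYu : mx_cvg (fun k => sqrt_iter Q k *m u) (Y *m u).
      exact: mx_cvg_mulmx cY (@mx_cvg_cst _ _ u).
    move=> i j; rewrite 2!mxE; under eq_fun do rewrite 2!mxE.
    by apply: cvgB (cYu i j); exact: cvg_cst.
  by move=> k; exact: sqrt_iter_supersolution.
- have cYY : mx_cvg (fun k => sqrt_iter Q k *m sqrt_iter Q k) (Y *m Y).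
    exact: (mx_cvg_mulmx cY cY).
  (* Pass to the limit in the recursion; solved for [Q], it reads Q = 2 Y - Y^2. *)
  have fixY : Y = 2^-1 *: (Q + Y *m Y).
    apply: (@mx_cvg_unique _ _ (fun k => sqrt_iter Q k.+1)) => i j.
      by have := cY i j; rewrite -cvg_shiftS.
    rewrite 2!mxE.
    under eq_fun do rewrite /sqrt_iter iterS -/(sqrt_iter Q _) 2!mxE.
    by apply: cvgM; [|apply: cvgD (cYY i j)]; exact: cvg_cst.
  have -> : Q = Y *+ 2 - Y ^+ 2.
    rewrite -scaler_nat {1}fixY scalerA divff ?pnatr_eq0 // scale1r.
    by rewrite expr2 -[Y * Y]/(Y *m Y) addrK.
  rewrite expr2 mulrBl mul1r mulrBr mulr1 -expr2 mulr2n.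
  by rewrite !opprD !opprK !addrA.
- by apply: mx_cvg_poly cY _ => k; exact: sqrt_iter_poly.
Qed.

End SqrtIteration.

(** * Uniqueness of the principal square root *)

Section PrincipalRootUniqueness.

Lemma eigenvalue_of_left_multiple (F : fieldType) n (X K : 'M[F]_n.+1) l :
  K != 0 -> K * X = l *: K -> eigenvalue X l.
Proof.
move=> K0 KX; have [i Ki] : exists i, row i K != 0.
  by apply/existsP; rewrite -negb_forall; apply: contra K0 => /forallP K0;
    apply/eqP/row_matrixP => i; rewrite row0; exact/eqP.
by apply/eigenvalueP; exists (row i K); rewrite // -row_mul -linearZ /= -KX.
Qed.

(** By Cayley-Hamilton, multiplying [k] by all the factors x - z, z running over the roots of the
    characteristic polynomial of x(A), gives 0 at [A]. Multiply by one factor at a time: the last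
    nonzero product is killed by the next x - z, so l = z. *)
Lemma horner_mx_eigenmultiple (F : closedFieldType) n (A : 'M[F]_n.+1)
    (k x : {poly F}) :
  horner_mx A k != 0 ->
  exists l q, horner_mx A (k * q) != 0 /\
    horner_mx A (k * q * x) = l *: horner_mx A (k * q).
Proof.
have [s Es] := closed_field_poly_normal (char_poly (horner_mx A x)).
have : horner_mx A (k * \prod_(z <- s) (x - z%:P)) = 0.
  rewrite rmorphM; have := Cayley_Hamilton (horner_mx A x).
  rewrite Es (monicP (char_poly_monic _)) scale1r !rmorph_prod => CH.
  rewrite -[RHS](mulr0 (horner_mx A k)) -CH; congr (_ * _).
  apply: eq_bigr => z _.
  by rewrite !rmorphB /= horner_mx_X !horner_mx_C.
elim: s k {Es} => [|z s IHs] k; first by rewrite big_nil mulr1 => -> /eqP.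
rewrite big_cons mulrA => kzs k0.
have [kz|kz] := eqVneq (horner_mx A (k * (x - z%:P))) 0; last first.
  have [l [q [kq kqx]]] := IHs _ kzs kz.
  by exists l, ((x - z%:P) * q); rewrite !mulrA.
exists z, 1; rewrite mulr1; split=> //; apply/eqP.
rewrite -subr_eq0 -mul_scalar_mx -(horner_mx_C A) mulmxE.
rewrite -[_ * horner_mx A k]rmorphM -rmorphB [z%:P * k]mulrC -mulrBr.
exact/eqP.
Qed.

Lemma principal_sqrt_unique (R : realType) n (A X1 X2 : 'M[R[i]]_n.+1) :
  (forall M, A * (A * M) = 0 -> A * M = 0) ->
  principal_sqrt_spec A X1 -> principal_sqrt_spec A X2 -> X1 = X2.
Proof.
move=> A_idx [sq1 [p1 E1] re1] [sq2 [p2 E2] re2].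
(* Evaluation at [A] is a ring morphism, so the argument can be run on polynomials, which
   commute. *)
have [h hE] : exists h : {rmorphism {poly R[i]} -> 'M[R[i]]_n.+1},
    h =1 horner_mx A by exists (horner_mx A).
rewrite -!hE in E1 E2.
have hX : h 'X = A by rewrite hE horner_mx_X.
have hXX p : h ('X * ('X * p)) = 0 -> h ('X * p) = 0.
  by rewrite !rmorphM /= hX; exact: A_idx.
have zw : h ((p1 - p2) * (p1 + p2)) = 0.
  by rewrite -subr_sqr rmorphB !rmorphXn /= -E1 -E2 sq1 sq2 subrr.
have hZX : h ('X * (p1 - p2)) = 0.
  apply/eqP/negPn/negP; rewrite hE => k0.
  have [l [q [kq0 kqp1]]] := horner_mx_eigenmultiple p1 k0.
  set k := _ * q in kq0 kqp1; rewrite -!hE in kq0 kqp1.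
  have kqp2 : h (k * p2) = - l *: h k.
    rewrite scaleNr -kqp1; apply/eqP; rewrite -addr_eq0 addrC -rmorphD -mulrDr.
    rewrite /k -!mulrA [q * _]mulrC [X in _ * X]mulrA mulrA.
    by rewrite 2!rmorphM /= zw mulr0 mul0r.
  have l0 : l = 0.
    apply/eqP/negPn/negP => l0.
    have : 0 < complex.Re l.
      apply: re1 => //; apply: (eigenvalue_of_left_multiple kq0).
      by rewrite E1 -rmorphM.
    have : 0 < complex.Re (- l).
      apply: re2; rewrite ?oppr_eq0 //; apply: (eigenvalue_of_left_multiple kq0).
      by rewrite E2 -rmorphM.
    by case: (l) => a b /=; rewrite oppr_gt0 => /lt_trans H /H; rewrite ltxx.
  rewrite l0 scale0r in kqp1.
  case/negP: kq0; apply/eqP; rewrite /k -mulrA; apply: hXX.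
  have -> : 'X * ('X * ((p1 - p2) * q)) = 'X * k by rewrite /k !mulrA.
  by rewrite mulrC rmorphM /= hX -sq1 E1 -rmorphXn -rmorphM /= expr2 mulrA
    rmorphM /= kqp1 mul0r.
suff : h (p1 - p2) = 0 by rewrite rmorphB /= -E1 -E2 => /subr0_eq.
have [Au|Anu] := boolP (A \is a GRing.unit).
  have : A * h (p1 - p2) = 0 by rewrite -{1}hX -rmorphM.
  by move=> A0; rewrite -(mulKr Au (h _)) A0 mulr0.
have [v v0 vA] : exists2 v : 'rV_n.+1, v != 0 & v *m A = 0.
  have : kermx A != 0 by rewrite kermx_eq0 row_free_unit.
  by case/rowV0Pn => v /sub_kermxP; exists v.
(* Since v A = 0, v X = p(0) v, hence p(0)^2 v = v A = 0. So [p1] and [p2] both vanish at 0 and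
   their difference is a multiple of ['X]. *)
have root0 X p : X ^+ 2 = A -> X = h p -> root p 0.
  move=> sqX EX.
  have vX : v *m X = p.[0] *: v.
    have [r Er] : exists r, p = r * 'X + (p.[0])%:P.
      have /factor_theorem [r Er] : root (p - (p.[0])%:P) 0.
        by rewrite /root hornerD hornerN hornerC subrr.
      by exists r; rewrite -[LHS](subrK (p.[0])%:P) Er subr0.
    rewrite EX {1}Er [_ + _]addrC rmorphD /= [r * _]mulrC rmorphM /= hX.
    by rewrite hE horner_mx_C mulmxDr mul_mx_scalar mulmxA vA mul0mx addr0.
  have : p.[0] *: (p.[0] *: v) = 0.
    by rewrite -{1}vX scalemxAl -vX -mulmxA mulmxE -expr2 sqX.
  by move/eqP; rewrite !scaler_eq0 (negPf v0) !orbF orbb.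
have /factor_theorem [r Er] : root (p1 - p2) 0.
  by rewrite /root hornerD hornerN (rootP (root0 _ _ sq1 E1))
    (rootP (root0 _ _ sq2 E2)) subrr.
move: hZX; rewrite Er subr0 [r * _]mulrC; exact: hXX.
Qed.

End PrincipalRootUniqueness.

(** * From the triplet of [A] to its square root *)

Section TripletSqrt.
Variables (R : realType) (n : nat).
Implicit Types (A X Y Q : 'M[R]_n.+1) (u : 'cV[R]_n.+1).

Lemma triplet_scaling A u :
  (forall i j, i != j -> A i j <= 0) -> mx_nonneg (A *m u) ->
  exists s Q, [/\ 0 < s, mx_nonneg Q, mx_nonneg (u - Q *m u),
    A = s *: (1 - Q) & exists q, Q = horner_mx A q].
Proof.
move=> Aoff Au.
(* This dominates every diagonal entry of [A], which makes the diagonal of 1 - A / s nonnegative;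
   the summand 1 keeps [s] positive. *)
pose s := 1 + \sum_i `|A i i|.
have s_gt0 : 0 < s by rewrite ltr_pwDl // sumr_ge0.
exists s, (1 - s^-1 *: A); split=> //.
- move=> i j; rewrite !mxE subr_ge0; have [<-|ij] := eqVneq i j.
    rewrite mulrC ler_pdivrMr // mul1r /s (bigD1 i) //=.
    apply: le_trans (ler_norm _) _; rewrite addrCA lerDl addr_ge0 //.
    exact: sumr_ge0.
  by rewrite mulr_ge0_le0 ?Aoff // invr_ge0 ltW.
- rewrite mulmxBl mul1mx subKr -scalemxAl.
  by apply: mx_nonnegZ; rewrite // invr_ge0 ltW.
- by rewrite subKr scalerA divff ?scale1r // gt_eqF.
- by exists (1 - s^-1 *: 'X); rewrite rmorphB rmorph1 /= horner_mxZ horner_mx_X.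
Qed.

(** Here z = s (1 - w) with w an eigenvalue of [Y], so |w| <= 1. Thus z lies in the closed disc of
    centre s and radius s, which meets the imaginary axis only at 0. *)
Lemma supersolution_eigenvalue_scaled Y u s z :
  mx_nonneg Y -> mx_pos u -> mx_nonneg (u - Y *m u) -> 0 < s ->
  eigenvalue (complex_mx (s *: (1 - Y))) z -> z != 0 -> 0 < complex.Re z.
Proof.
move=> Y0 u0 Yu s0 /eigenvalueP [v vX v0] z0.
have s0' : s%:C%C != 0 :> R[i] by rewrite eq_complex /= gt_eqF.
have : eigenvalue (complex_mx Y) (1 - (s%:C)^-1%C * z).
  apply/eigenvalueP; exists v => //.
  have -> : complex_mx Y = 1%:M - (s%:C)^-1%C *: complex_mx (s *: (1 - Y)).
    rewrite /complex_mx map_mxZ scalerA mulVf // scale1r map_mxB map_mx1.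
    by rewrite subKr.
  by rewrite mulmxBr mulmx1 -scalemxAr vX scalerA scalerBl scale1r.
move/(supersolution_eigenvalue_le (c := 1) Y0 u0); rewrite scale1r => /(_ Yu).
have -> : 1 - (s%:C)^-1%C * z = Complex (1 - s^-1 * complex.Re z)
  (- (s^-1 * complex.Im z)).
  rewrite -fmorphV; case: (z) => a b.
  by apply/eqP; rewrite eq_complex /=; apply/andP; split; apply/eqP; ring.
rewrite /= -[X in _ <= X](sqrtr1) ler_sqrt // sqrrN => le1.
rewrite ltNge; apply: contra z0 => a_le0.
have c0 : 0 < s^-1 by rewrite invr_gt0.
move: le1; rewrite eq_complex /=.
set a := complex.Re z in a_le0 *; set b := complex.Im z; set c := s^-1 in c0 *.
move=> le1.
(* Expanding (1 - c a)^2 + (c b)^2 <= 1 with c a <= 0 leaves a sum of nonnegative terms that is at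
   most 0, so each vanishes. *)
have ca : c * a <= 0 by rewrite pmulr_rle0.
have ca2 := sqr_ge0 (c * a); have cb2 := sqr_ge0 (c * b).
have ca_eq : c * a = 0 by nra.
have cb_eq : (c * b) ^+ 2 = 0 by nra.
move/eqP: ca_eq; move/eqP: cb_eq; rewrite sqrf_eq0 !mulf_eq0 gt_eqF //=.
by move=> -> ->.
Qed.

(** The real statement, applied to a cokernel of A^2, yields a factorisation A = G A^2. This
    identity survives extension of scalars and gives A M = G (A (A M)) = 0. *)
Lemma supersolution_index1_complex A Q u s :
  mx_nonneg Q -> mx_pos u -> mx_nonneg (u - Q *m u) -> A = s *: (1 - Q) ->
  s != 0 ->
  forall M, complex_mx A * (complex_mx A * M) = 0 -> complex_mx A * M = 0.
Proof.
move=> Q0 u0 Qu AE s0 M AAM.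
have /submxP [G AG] : (A <= A *m A)%MS.
  rewrite submxE; set C := cokermx _; apply/eqP.
  have : A *m (A *m C) = 0 by rewrite mulmxA mulmx_coker.
  rewrite AE -!(scalemxAl, scalemxAr) => /eqP; rewrite !scaler_eq0.
  rewrite (negPf s0) /= => /eqP BBC.
  by rewrite (supersolution_index1 Q0 u0 Qu BBC) scaler0.
rewrite {1}AG /complex_mx !map_mxM /= -!mulmxE -!mulmxA.
by rewrite -!/(complex_mx _) !mulmxE AAM mulr0.
Qed.

End TripletSqrt.

Theorem theorem9 (R : realType) (n : nat) (A : 'M[R]_n.+1)
    (hM : is_Mmatrix A) (hT : has_triplet_representation A) :
  exists X : 'M[R]_n.+1,
    [/\ is_principal_sqrt (complex_mx A) (complex_mx X),
        is_Mmatrix X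
      & has_triplet_representation X].
Proof.
have [P [u [v [PE P0 u0 v0 Auv]]]] := hT.
have Aoff i j : i != j -> A i j <= 0.
  by move=> ij; have := P0 i j; rewrite PE mxE (negPf ij) oppr_ge0.
rewrite -Auv in v0.
have [s [Q [s0 Q0 Qu AE QA]]] := triplet_scaling Aoff v0.
have [Y [Y0 Yu sqY [p Yp]]] := nonneg_sqrt_fixpoint Q0 u0 Qu QA.
pose r := Num.sqrt s; have r0 : 0 < r by rewrite sqrtr_gt0.
pose X := r *: (1 - Y).
have XE : X = horner_mx A (r *: (1 - p)).
  by rewrite horner_mxZ rmorphB rmorph1 /= -Yp.
have X0 : mx_nonneg (X *m u).
  rewrite -scalemxAl mulmxBl mul1mx.
  by apply: mx_nonnegZ; rewrite // ltW.
exists X; split.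
- have specX : principal_sqrt_spec (complex_mx A) (complex_mx X).
    split.
    + rewrite /complex_mx -rmorphXn /= exprZn sqY AE sqr_sqrtr //.
      exact: ltW.
    + exists (map_poly (real_complex R) (r *: (1 - p))).
      by rewrite XE /complex_mx map_horner_mx.
    + by move=> z; apply: supersolution_eigenvalue_scaled Y0 u0 Yu r0.
  split=> // X' specX'.
  apply: principal_sqrt_unique specX specX'.
  by apply: supersolution_index1_complex Q0 u0 Qu AE _; rewrite gt_eqF.
(* The splitting is X = r I - r Y; the same [u] shows that the spectral radius of r Y is at most
   r. *)
- exists r, (r *: Y); split.
  + by rewrite /X scalerBr scalemx1.
  + by apply: mx_nonnegZ => //; exact: ltW.
  + apply: (supersolution_spectral_radius_le (u := u)) => //.
    * by apply: mx_nonnegZ => //; exact: ltW.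
    * exact: ltW.
    * by rewrite -scalemxAl -scalerBr; apply: mx_nonnegZ => //; exact: ltW.
(* The vector [u] is kept, as X u = r (u - Y u) is nonnegative; off the diagonal, -X is r Y. *)
- exists (\matrix_(i, j) (if i == j then 0 else - X i j)), u, (X *m u).
  split=> // i j; rewrite mxE; case: ifPn => // ij.
  rewrite !mxE (negPf ij) sub0r mulrN opprK.
  by rewrite mulr_ge0 // ltW.
Qed.
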